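(* There are functions $g,h$ with $g(q)/q\to 0$ and $h(q)/q\to 0$ as $q\to\infty$, and for each $q$ a positive integer $N_q$ with $\log_q N_q = q-g(q)$, such that the number of words $w$ of length $N_q$ over an alphabet of size $q$ with the following two properties is at least $q^{q^{\,q-h(q)}}$: (i) $w$ avoids $Z_3$; (ii) there is a letter $d$ such that every subword of $w$ not containing the letter $d$ avoids $Z_2$.
   Context: A word over an alphabet is a finite string of letters; a subword of $w$ is a string of consecutive letters of $w$. A word $w$ contains a pattern $P$ if there is a map assigning to each letter of $P$ a nonempty word (different letters may receive equal words) such that the word obtained from $P$ by replacing each letter by its assigned word is a subword of $w$; otherwise $w$ avoids $P$. $Z_2=x_1x_2x_1$ and $Z_3=x_1x_2x_1x_3x_1x_2x_1$. *)

(* Defs.v *)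
From mathcomp Require Import all_boot all_order all_algebra.
From mathcomp Require Import all_classical all_reals all_analysis.

Set Implicit Arguments.
Unset Strict Implicit.
Unset Printing Implicit Defensive.

Import Order.TTheory GRing.Theory Num.Theory.
Import numFieldNormedType.Exports.

Local Open Scope ring_scope.

(* Only the letters occurring in [P] have to receive a nonempty word. *)
Definition contains_pattern (B A : eqType) (P : seq B) (w : seq A) : Prop :=
  exists f : B -> seq A,
    (forall x, x \in P -> f x != [::]) /\ infix (flatten (map f P)) w.

Definition avoids (B A : eqType) (P : seq B) (w : seq A) : Prop :=
  ~ contains_pattern P w.

Definition Z2 : seq nat := [:: 1; 2; 1]%N.
Definition Z3 : seq nat := [:: 1; 2; 1; 3; 1; 2; 1]%N.

Definition Z2_free_off_letter (A : eqType) (w : seq A) : Prop :=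
  exists d : A, forall u : seq A, infix u w -> d \notin u -> avoids Z2 u.

Definition log_base (R : realType) (b x : R) : R := ln x / ln b.

(* Main.v *)
(* With T the q - 1 letters other than d, take a sequence c over T, as long as the number of
   repetition-free words of length L = q - 2, whose windows of length L are repetition-free and
   pairwise distinct. Cut c into blocks of length L and put d or dd before each of them, so that
   every d-free subword is repetition-free. An occurrence of Z_3 gives two occurrences of some
   aYa with a a letter and Y nonempty; deleting d from aYa leaves at least L letters, since a
   does not recur within L letters of c when a <> d, and Y contains a whole block when a = d.
   So a window of c would occur twice. There are (q - 3)! pairs of blocks, and in each pair the
   choice of which block receives dd is free. *)
Require Import Defs.
From mathcomp Require Import all_boot all_order all_algebra perm zify ring lra.
From mathcomp Require Import all_classical all_reals all_analysis.

Import Order.TTheory GRing.Theory Num.Theory.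
Import numFieldNormedType.Exports.

Set Implicit Arguments.
Unset Strict Implicit.
Unset Printing Implicit Defensive.

(** * A sequence running through all repetition-free words *)

(* A letter outside the word serves as a spare: if the letter wanted at some place occurs further
   on, it is first replaced there by the spare one. *)
Lemma uniq_words_connected (T : finType) (P : seq T -> Prop) (u s t : seq T) :
  (forall r, P r -> uniq r) ->
  (forall a r, P (a :: r) -> P (rcons r a)) ->
  (forall a b r, P (a :: r) -> b \notin r -> P (b :: r)) ->
  size (u ++ s) < #|T| -> size s = size t -> uniq (u ++ t) ->
  P (u ++ s) -> P (u ++ t).
Proof.
move=> Puniq Prcons Pchange.
have Prot r1 : forall r2, P (r1 ++ r2) -> P (r2 ++ r1).
  elim: r1 => [|a r1 IHr] r2 /=; first by rewrite cats0.
  by move=> /Prcons; rewrite rcons_cat => /IHr; rewrite cat_rcons.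
(* Rotation brings any letter to the front, where it can be changed, and then back to its place. *)
have Preplace b r1 a r2 : P (r1 ++ a :: r2) -> b \notin r1 ++ r2 ->
    P (r1 ++ b :: r2).
  move=> /Prot Pr nb; apply: (Prot (b :: r2)); apply: Pchange Pr _.
  by rewrite mem_cat orbC -mem_cat.
elim: t u s => [|b t IHt] u [|a s] //= szT [szst] ut Pu.
(* It suffices to get b right after u, with any remainder of the right length: the induction
   hypothesis then corrects the remainder. *)
have step r : size r = size t -> P (u ++ b :: r) -> P (u ++ b :: t).
  move=> szr; rewrite -!cat_rcons; apply: IHt => //; last by rewrite cat_rcons.
  by move: szT; rewrite !size_cat size_rcons /= szr szst addSnnS.
have [bus|] := boolP (b \in u ++ s); last first.
  by move=> nb; apply: (step s) => //; apply: Preplace Pu nb.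
have bs : b \in s.
  move: bus; rewrite mem_cat; case/orP=> // bu.
  by move: ut; rewrite cat_uniq /= bu /= andbF.
have [s1 [s2 es]] : exists s1 s2, s = s1 ++ b :: s2.
  by move: bs => /path.splitPr[s1 s2]; exists s1, s2.
rewrite {bus bs}es in szst szT Pu.
have uw := Puniq _ Pu.
have [z nz] : exists z, z \notin u ++ a :: s1 ++ b :: s2.
  apply/existsP; apply: contraTT szT; rewrite negb_exists -leqNgt => /forallP all_in.
  rewrite -(card_uniqP uw); apply/subset_leq_card/fintype.subsetP => z _.
  by have := all_in z; rewrite negbK.
have zb : z != b by apply: contraNneq nz => ->; rewrite !(mem_cat, inE) eqxx !orbT.
have Pz : P ((u ++ a :: s1) ++ z :: s2).
  apply: (Preplace _ _ b); first by rewrite -catA.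
  apply: contraNN nz; rewrite !(mem_cat, inE).
  by case: (z \in u); case: (z == a); case: (z \in s1); case: (z \in s2); rewrite ?orbT.
apply: (step (s1 ++ z :: s2)); first by rewrite -szst !size_cat.
apply: Preplace; first by rewrite -catA in Pz; exact: Pz.
move: uw; rewrite -cat_cons catA uniq_catC /= => /andP[nb _].
apply: contraNN nb; rewrite !(mem_cat, inE) (eq_sym b z) (negPf zb) /=.
by case: (b \in u); case: (b == a); case: (b \in s1); case: (b \in s2).
Qed.

(* A successor map with the fewest orbits merges all words sharing their tail: if x and y have the
   same tail but lie in different orbits, exchanging their successors joins the two orbits. *)
Lemma uniq_words_single_orbit (T : finType) (l : nat) : l.+1 < #|T| ->
  exists f : {perm l.+1.-tuple T},
    [/\ forall x : l.+1.-tuple T, take l (f x) = behead x,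
        forall x : l.+1.-tuple T, uniq (f x) = uniq x &
        forall x y : l.+1.-tuple T, uniq x -> uniq y -> y \in porbit f x].
Proof.
move=> lT; pose X := l.+1.-tuple T.
pose valid (f : {perm X}) :=
  [forall x : X, (take l (f x) == behead x) && (uniq (f x) == uniq x)].
(* Rotation is one valid successor map, so one with fewest orbits exists. *)
have rot_inj : injective (fun x : X => [tuple of rot 1 x]).
  by move=> x y /(congr1 val) /rot_inj/val_inj.
have valid_rot : valid (perm rot_inj).
  apply/forallP => x; rewrite permE /= rot_uniq eqxx andbT.
  case/tupleP: x => a t /=; rewrite rot1_cons -cats1 take_size_cat ?size_tuple //.
have [f /forallP validf minf] := arg_minnP (fun f => #|porbits f|) valid_rot.
have takef (x : X) : take l (f x) = behead x by have /andP[/eqP] := validf x.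
have uniqf (x : X) : uniq (f x) = uniq x by have /andP[_ /eqP] := validf x.
have tail_orbit (x y : X) : uniq x -> uniq y -> behead x = behead y -> y \in porbit f x.
  move=> ux uy xy; apply/negPn/negP => nyx.
  have valid_swap : valid (tperm x y * f)%g.
    apply/forallP => z; rewrite permM.
    case: tpermP => [->|->|_ _]; rewrite ?takef ?uniqf ?ux ?uy ?xy ?eqxx //.
  have := porbits_mul_tperm f x y; rewrite porbit_sym nyx /= => eq_card.
  have := minf _ valid_swap; rewrite leqNgt => /negP; apply.
  by rewrite -ltnS -addn2 eq_card -[X in _ <= X]addn1 leq_add2l leq_b1.
exists f; split=> // x y ux uy.
pose P r := uniq r /\ exists2 z : X, val z = r & z \in porbit f x.
have [_ [z /val_inj <- //]] : P y.
apply: (@uniq_words_connected T P [::] x y) => //=.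
- by move=> r [].
- move=> a r [ur [z zE xz]].
  have szr : size r = l by move: (size_tuple z); rewrite /= zE => -[].
  split; first by rewrite rcons_uniq.
  exists [tuple of rot 1 z]; first by rewrite /= zE rot1_cons.
  (* The preimage y' of r a under f has tail r, as z has; so y' lies in the orbit of z, and its
     image r a does too. *)
  set z' := [tuple of _]; pose y' := (f^-1)%g z'.
  have fy' : f y' = z' by rewrite permKV.
  have z'E : val z' = rcons r a by rewrite /= zE rot1_cons.
  have : y' \in porbit f z.
    apply: tail_orbit; rewrite ?zE //.
      by rewrite -uniqf fy' z'E rcons_uniq.
    by rewrite -takef fy' z'E -cats1 take_size_cat.
  rewrite -!eq_porbit_mem in xz * => /eqP y'z.
  by rewrite -(eqP xz) -y'z -fy' -[f y']/((f ^+ 1)%g y') porbit_perm.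
- move=> a b r [ur [z zE xz]] br.
  have szr : size (b :: r) == l.+1 by rewrite -(size_tuple z) /= zE.
  have ubr : uniq (b :: r) by rewrite /= br; case/andP: ur.
  split=> //; exists (Tuple szr) => //.
  have : Tuple szr \in porbit f z by apply: tail_orbit; rewrite ?zE.
  by rewrite -!eq_porbit_mem in xz * => /eqP ->.
- by rewrite size_tuple.
- by rewrite !size_tuple.
by split=> //; exists x => //; apply: porbit_id.
Qed.

(** The sequence c reads the first letters along the single orbit. Successors overlap, so the
    windows of c are the iterates of f, and one turn around the orbit meets every repetition-free
    word once. *)
Lemma distinct_uniq_windows (T : finType) (l : nat) : l.+1 < #|T| ->
  exists c : nat -> T,
    (forall i, uniq (map c (iota i l.+1))) /\
    {in [pred i | i < #|T| ^_ l.+1] &,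
      injective (fun i => map c (iota i l.+1))}.
Proof.
move=> lT; have [f [takef uniqf orbf]] := uniq_words_single_orbit lT.
have cardU : #|[set x : l.+1.-tuple T | uniq x]| = #|T| ^_ l.+1.
  rewrite -[#|T|]/#|predT| -card_uniq_tuples; apply: eq_card => x.
  by rewrite !inE all_predT.
have [x0 ux0] : exists x : l.+1.-tuple T, uniq x.
  have : 0 < #|[set x : l.+1.-tuple T | uniq x]| by rewrite cardU ffact_gt0 ltnW.
  by case/card_gt0P => x; rewrite inE; exists x.
pose c i := thead (iter i f x0).
have uit i : uniq (iter i f x0) by elim: i => //= i; rewrite uniqf.
have nth_it a j i : j <= l -> nth a (iter i f x0) j = c (i + j).
  elim: j i => [|j IHj] i jl; first by rewrite addn0 /c /thead (tnth_nth a).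
  by rewrite addnS -addSn -IHj ?(ltnW jl) // -nth_behead -takef nth_take.
have cE i : map c (iota i l.+1) = iter i f x0.
  apply: (@eq_from_nth _ (thead x0)) => [|j]; rewrite size_map size_iota ?size_tuple //.
  move=> jl; rewrite (nth_map 0) ?size_iota // nth_iota // nth_it //.
have cardO : #|porbit f x0| = #|T| ^_ l.+1.
  rewrite -cardU; apply: eq_card => x; rewrite inE; apply/idP/idP; last exact: orbf.
  by case/porbitP => i ->; rewrite permX uit.
exists c; split=> [i|i j]; first by rewrite cE.
rewrite !inE -cardO => iO jO; rewrite !cE => /val_inj.
rewrite -!(nth_traject f (n := #|porbit f x0|)) //.
move/eqP; rewrite nth_uniq ?size_traject ?uniq_traject_porbit //.
by move/eqP.
Qed.

(** * The block automaton and pattern avoidance *)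

(* The states of the automaton recognising concatenations of runs of one or two d and blocks of L
   other letters: a state s <= L counts the letters read in the current block, L + r records
   that r letters d have been read since its end. *)
Definition block_step (A : eqType) (d : A) (L s : nat) (x : A) : option nat :=
  if x == d then if L <= s <= L.+1 then Some s.+1 else None
  else if s < L then Some s.+1 else if s == L then None else Some 1.

Definition block_run (A : eqType) (d : A) (L s : nat) (w : seq A) : option nat :=
  foldl (fun o x => obind (block_step d L ^~ x) o) (Some s) w.

Section BlockRun.
Variables (A : eqType) (d : A) (L : nat).
Implicit Types (s : nat) (u v w : seq A).
Local Notation run := (block_run d L).

Lemma block_run_cat s u v :
  run s (u ++ v) = obind (run ^~ v) (run s u).
Proof.
rewrite /block_run foldl_cat; case: (foldl _ _ u) => //=.
by elim: v.
Qed.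

Lemma block_run_rcons s u x :
  run s (rcons u x) = obind (block_step d L ^~ x) (run s u).
Proof. by rewrite -cats1 block_run_cat. Qed.

Lemma block_run1 s x : run s [:: x] = block_step d L s x.
Proof. by []. Qed.

(** The state s' is the one reached before u, which is why runs may start anywhere. *)
Lemma block_run_infix s u w : infix u w -> run s w -> exists s', run s' u.
Proof.
move=> /infixP[w1 [w2 ->]]; rewrite !block_run_cat.
case: (run s w1) => //= s' us'; exists s'.
by move: us'; rewrite block_run_cat; case: (run s' u).
Qed.

Lemma block_run_ddd s u : ~~ run s [:: d, d, d & u].
Proof.
rewrite -[_ :: _]/([:: d; d; d] ++ u) block_run_cat.
suff -> : run s [:: d; d; d] = None by [].
rewrite /block_run /= /block_step eqxx.
case: ifP => //= /andP[Ls _]; case: ifP => //= _.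
by case: ifP => // /andP[_]; rewrite !ltnS leqNgt ltnS Ls.
Qed.

(** Without d the counter can be reset only at the first letter, so it ends no lower than the number
    of letters read. Hence a d-free subword fits within a block. *)
Lemma block_run_size s s' u :
  0 < L -> d \notin u -> u != [::] -> run s u = Some s' -> size u <= s' <= L.
Proof.
move=> L0; elim/last_ind: u s' => // u x IHu s'.
rewrite mem_rcons inE negb_or eq_sym => /andP[xd du] _.
rewrite block_run_rcons size_rcons.
case E: (run s u) => [t|] //=; rewrite /block_step (negPf xd).
have {IHu} IHu : u = [::] \/ size u <= t <= L.
  have [->|u0] := eqVneq u [::]; [by left | by right; apply: IHu].
case: ltngtP => //= [tL|Lt] [<-].
  by case: IHu => [->|/andP[ut _]] /=; rewrite tL ?andbT ?ltnS ?ut.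
by case: IHu => [->//|/andP[_]]; rewrite leqNgt Lt.
Qed.

Lemma block_run_dfree s u :
  L < s -> d \notin u -> u != [::] -> size u <= L -> run s u = Some (size u).
Proof.
move=> Ls; elim/last_ind: u => // u x IHu.
rewrite mem_rcons inE negb_or eq_sym => /andP[xd du] _.
rewrite block_run_rcons size_rcons => uL.
have [->|u0] := eqVneq u [::].
  by rewrite /= /block_step (negPf xd) ltnNge (ltnW Ls) /= gtn_eqF.
by rewrite IHu ?(ltnW uL) //= /block_step (negPf xd) uL.
Qed.

(** For a run starting just after a d, the current block lies wholly inside u. If another d can
    follow, then L <= s', so u has either no letter other than d or at least L of them. *)
Lemma block_run_count s s' u :
  L < s -> run s u = Some s' ->
  (count (predC1 d) u = 0 /\ L < s') \/ minn s' L <= count (predC1 d) u.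
Proof.
move=> Ls; elim/last_ind: u s' => [s' [<-]|u x IHu s']; first by left.
rewrite block_run_rcons -cats1 count_cat /=.
case E: (run s u) => [t|] //=; rewrite /block_step.
have {IHu E}IHu := IHu _ E.
case: eqVneq => [_|xd] /=.
  case: ifP => // /andP[Lt _] [<-]; rewrite !addn0.
  case: IHu => [[-> _]|]; first by left; split=> //; rewrite ltnS.
  by rewrite (minn_idPr Lt) (minn_idPr (leqW Lt)); right.
rewrite addn0 addn1; case: ltngtP => //= [tL|Lt] [<-]; right; last first.
  by rewrite geq_min.
case: IHu => [[_]|]; first by rewrite ltnNge (ltnW tL).
by rewrite (minn_idPl (ltnW tL)) (minn_idPl tL).
Qed.

End BlockRun.

Lemma not_uniq_repeat (A : eqType) (a : A) (u v w : seq A) :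
  uniq (u ++ a :: v ++ a :: w) = false.
Proof.
by rewrite cat_uniq /= mem_cat mem_head orbT !andbF.
Qed.

Lemma infix_filter (A : eqType) (a : pred A) (u w : seq A) :
  infix u w -> infix (seq.filter a u) (seq.filter a w).
Proof.
move=> /infixP[w1 [w2 ->]]; apply/infixP; exists (seq.filter a w1), (seq.filter a w2).
by rewrite !filter_cat.
Qed.

Lemma marked_word_avoids (A : eqType) (d : A) (L s : nat) (w : seq A) :
  let p := seq.filter (predC1 d) w in
  0 < L -> block_run d L s w ->
  (forall u, infix u p -> size u <= L -> uniq u) ->
  (forall u s1 s2 t1 t2, size u = L ->
    p = s1 ++ u ++ s2 -> p = t1 ++ u ++ t2 -> size s1 = size t1) ->
  avoids Z3 w /\ Z2_free_off_letter w.
Proof.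
move=> p L0 run_w uniq_p inj_p.
have dfreeE u : d \notin u -> seq.filter (predC1 d) u = u.
  by move=> du; apply/all_filterP/allP => x xu /=; apply: contraNneq du => <-.
split.
  case=> f [f0] /=; rewrite cats0.
  case f1E: (f 1) (f0 1 isT) => [//|a f1] _ Vw.
  (* The image of Z_3 is V Z V followed by f1. *)
  pose Y := f1 ++ f 2; pose V := a :: Y ++ [:: a]; pose Z := f1 ++ f 3.
  have {Vw} Vw : infix (V ++ Z ++ V) w.
    apply: infix_trans Vw; apply/infixP; exists [::], f1.
    by rewrite /V /Y /Z; do 4!rewrite -?catA /=.
  have Y0 : Y != [::].
    by rewrite /Y -size_eq0 size_cat addn_eq0 negb_and orbC size_eq0 f0.
  have VVw : infix V w by apply: infix_trans Vw; apply: prefixW; apply: prefix_prefix.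
  have Vp := infix_filter (predC1 d) VVw; rewrite -/p in Vp.
  (* Otherwise the two copies of V, with d deleted, give the same L letters at different places of
     p. *)
  suff LV : L <= size (seq.filter (predC1 d) V).
    move: (infix_filter (predC1 d) Vw) => /infixP[p1 [p2]]; rewrite -/p.
    rewrite (filter_cat _ V) (filter_cat _ Z).
    set v := seq.filter _ V in LV *; set z := seq.filter _ Z => pE.
    have pE1 : p = p1 ++ take L v ++ (drop L v ++ z ++ v ++ p2).
      by rewrite pE (catA (take L v)) cat_take_drop -!catA.
    have pE2 : p = (p1 ++ v ++ z) ++ take L v ++ (drop L v ++ p2).
      by rewrite pE (catA (take L v)) cat_take_drop -!catA.
    have := inj_p _ _ _ _ _ (size_takel LV) pE1 pE2.
    rewrite !size_cat -{1}[size p1]addn0 => /eqP; rewrite eqn_add2l eq_sym addn_eq0.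
    by rewrite eqn0Ngt (leq_trans L0 LV).
  have [ad|ad] := eqVneq a d; last first.
    rewrite leqNgt; apply/negP => /ltnW LV; have := uniq_p _ Vp LV.
    by rewrite /V /= ad filter_cat /= ad mem_cat mem_head orbT.
  have [t runV] := block_run_infix VVw run_w.
  rewrite /V ad /= eqxx /= filter_cat /= eqxx cats0 size_filter.
  move: runV; rewrite /V ad -[_ :: _]/([:: d] ++ Y ++ [:: d]) => runV.
  have := runV; rewrite block_run_cat block_run1 /block_step eqxx.
  case: ifP => //= /andP[Lt _]; rewrite block_run_cat.
  case E: (block_run d L t.+1 Y) => [t'|] //=.
  rewrite block_run1 /block_step eqxx; case: ifP => // /andP[Lt' _] _.
  (* The closing d requires L <= t', so Y has at least L letters other than d or consists of d only;
     in the latter case V begins with ddd. *)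
  have [[cY _]|] := block_run_count (Lt : L < t.+1) E; last by rewrite (minn_idPr Lt').
  have Yd : all (pred1 d) Y.
    by rewrite -[all _ _]negbK -has_predC has_count -leqNgt cY.
  case: Y Y0 Yd runV {E cY VVw Vp Vw V Z} => [//|y Y] _ /= /andP[/eqP -> Yd].
  case: Y Yd => [|y' Y] /= => [_|/andP[/eqP-> _]] runV.
    by have := block_run_ddd d L t [::]; rewrite runV.
  by have := block_run_ddd d L t (Y ++ [:: d]); rewrite runV.
(* A d-free occurrence of Z_2 fits within a block and is thus repetition-free, yet its first letter
   recurs. *)
exists d => u uw du [f [f0]] /=; rewrite cats0 => Vu.
case f1E: (f 1) (f0 1 isT) => [//|a f1] _; rewrite f1E in Vu.
have Vw := infix_trans Vu uw.
have dV : d \notin (a :: f1) ++ f 2 ++ a :: f1 by apply: contraNN du; apply: mem_infix.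
have [t] := block_run_infix Vw run_w.
case E: (block_run _ _ _ _) => [t'|] // _.
have /andP[Vt tL] := block_run_size L0 dV isT E.
have := infix_filter (predC1 d) Vw; rewrite (dfreeE _ dV) => Vp.
have := uniq_p _ Vp (leq_trans Vt tL).
by rewrite cat_cons catA (not_uniq_repeat a [::]).
Qed.

(** * Construction and number of the marked words *)

Definition marked_block (A : eqType) (d : A) (L : nat) (c : nat -> A) (m : nat)
    (b : bool) : seq A :=
  nseq b.+1 d ++ map c (iota m L).

(* Each Boolean chooses which of two consecutive blocks is preceded by dd, so that the length of
   the word does not depend on the choices. *)
Fixpoint marked_word (A : eqType) (d : A) (L : nat) (c : nat -> A) (m : nat)
    (bs : seq bool) : seq A :=
  if bs is b :: bs' then
    marked_block d L c m b ++ marked_block d L c (m + L) (~~ b)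
      ++ marked_word d L c (m + L + L) bs'
  else [::].

Section MarkedWord.
Variables (A : eqType) (d : A) (L : nat) (c : nat -> A).
Hypotheses (L0 : 0 < L) (cd : forall i, c i != d).
Local Notation block := (marked_block d L c).
Local Notation word := (marked_word d L c).

Let dc i k : d \notin map c (iota i k).
Proof. by apply/mapP => -[j _ /eqP]; rewrite eq_sym (negPf (cd j)). Qed.

Let word_cons m b bs : word m (b :: bs) =
  block m b ++ block (m + L) (~~ b) ++ word (m + L + L) bs.
Proof. by []. Qed.

Lemma size_marked_block m b : size (block m b) = L + b.+1.
Proof. by rewrite size_cat size_nseq size_map size_iota addnC. Qed.

Lemma size_marked_word m bs : size (word m bs) = L.*2.+3 * size bs.
Proof.
elim: bs m => [|b bs IHbs] m; first by rewrite muln0.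
rewrite word_cons 2!(size_cat (block _ _)) !size_marked_block IHbs.
rewrite -[size (b :: bs)]/(size bs).+1 mulnS -addnn.
by case: b; rewrite /negb /nat_of_bool; lia.
Qed.

Lemma filter_marked_word m bs :
  seq.filter (predC1 d) (word m bs) = map c (iota m (L.*2 * size bs)).
Proof.
have fb i b : seq.filter (predC1 d) (block i b) = map c (iota i L).
  rewrite filter_cat filter_nseq /= eqxx mul0n /=.
  by apply/all_filterP/allP => _ /mapP[j _ ->] /=.
elim: bs m => [|b bs IHbs] m; first by rewrite muln0.
rewrite word_cons 2!(filter_cat _ (block _ _)) !fb IHbs.
rewrite -[size (b :: bs)]/(size bs).+1 mulnS -addnn.
by rewrite !iotaD !map_cat -catA addnA.
Qed.

Let block_run_cat_some s s' u v :
  block_run d L s u = Some s' -> block_run d L s (u ++ v) = block_run d L s' v.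
Proof. by rewrite block_run_cat => ->. Qed.

Lemma block_run_marked_word m bs : block_run d L L (word m bs) = Some L.
Proof.
have run_block b i : block_run d L L (block i b) = Some L.
  have run_d : block_run d L L (nseq b.+1 d) = Some (L + b.+1).
    rewrite /block_run; case: b => /=; rewrite /block_step eqxx leqnn leqnSn /= ?addn1 //.
    by rewrite leqnSn leqnn addn2.
  rewrite block_run_cat run_d /= block_run_dfree ?size_map ?size_iota ?dc //.
    by rewrite addnS ltnS leq_addr.
  by rewrite -size_eq0 size_map size_iota -lt0n.
elim: bs m => [//|b bs IHbs] m.
by rewrite word_cons; do 2!rewrite (block_run_cat_some _ (run_block _ _)) //.
Qed.

Lemma marked_word_inj m bs bs' :
  size bs = size bs' -> word m bs = word m bs' -> bs = bs'.
Proof.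
elim: bs bs' m => [|b bs IHbs] [|b' bs'] m // [szb] eqw.
have bb' : b = b'.
  (* Position 1 holds d exactly when the first block gets dd; as L > 0, it otherwise holds a letter
     of c and not the default d. *)
  have := congr1 (fun w => nth d w 1) eqw.
  case: b b' L L0 {eqw} => [] [] [|k] //= _ /eqP; rewrite ?(negPf (cd m)) //.
  by rewrite eq_sym (negPf (cd m)).
congr cons => //; apply: (IHbs _ (m + L + L) szb).
by move/eqP: eqw; rewrite !word_cons bb' !eqseq_cat // !eqxx => /eqP.
Qed.
End MarkedWord.

Lemma map_iota_infix (A : Type) (c : nat -> A) (m n : nat) (s1 u s2 : seq A) :
  map c (iota m n) = s1 ++ u ++ s2 -> u = map c (iota (m + size s1) (size u)).
Proof.
move=> eqc; have sz : n = size s1 + (size u + size s2).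
  by rewrite -!size_cat -eqc size_map size_iota.
move: eqc; rewrite sz !iotaD !map_cat.
move/(congr1 (drop (size s1))); rewrite !drop_size_cat ?size_map ?size_iota //.
by move/(congr1 (take (size u))); rewrite !take_size_cat ?size_map ?size_iota.
Qed.

Lemma card_avoiding_words (q l K : nat) :
  l.+2 < q -> l.+1.*2 * K <= q.-1 ^_ l.+1 ->
  2 ^ K <= #|[set w : (l.+1.*2.+3 * K).-tuple 'I_q |
               `[< avoids Z3 w /\ Z2_free_off_letter w >] ]|.
Proof.
case: q => // n; rewrite ltnS /= => ln Kn.
have [c [uniq_c inj_c]] : exists c : nat -> 'I_n,
    (forall i, uniq (map c (iota i l.+1))) /\
    {in [pred i | i < n ^_ l.+1] &, injective (fun i => map c (iota i l.+1))}.
  by have := @distinct_uniq_windows 'I_n l; rewrite card_ord; apply.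
(* The letter 0 serves as d, and [lift ord0] sends c into the other q - 1 letters. *)
pose L := l.+1; pose c' i := lift ord0 (c i).
have c'0 i : c' i != ord0 by rewrite eq_sym neq_lift.
have c'E i k : map c' (iota i k) = map (lift ord0) (map c (iota i k)).
  by rewrite -map_comp.
have uniq_c' i k : k <= L -> uniq (map c' (iota i k)).
  move=> kL; rewrite c'E map_inj_uniq; last exact: lift_inj.
  by have := uniq_c i; rewrite -/L -(subnKC kL) iotaD map_cat cat_uniq => /and3P[].
pose word (t : K.-tuple bool) := marked_word ord0 L c' 0 t.
have szw t : size (word t) == L.*2.+3 * K by rewrite size_marked_word // size_tuple.
pose wt t := Tuple (szw t).
have wt_inj : injective wt.
  move=> t t' /(congr1 val) /= /(marked_word_inj _ c'0) eqt.
  by apply/val_inj/eqt; rewrite ?size_tuple.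
rewrite -card_bool -card_tuple -cardsT -(card_imset _ wt_inj).
apply/subset_leq_card/fintype.subsetP => _ /imsetP[t _ ->].
rewrite inE; apply/asboolP.
have pE := filter_marked_word L c'0 0 t.
apply: (@marked_word_avoids _ ord0 L L) => //; rewrite -/(word _) ?pE.
- by rewrite block_run_marked_word.
- by move=> u /infixP[s1 [s2 /map_iota_infix ->]]; rewrite size_map size_iota; apply: uniq_c'.
move=> u s1 s2 t1 t2 szu eqs eqt.
(* The 2 L K letters number at most n ^_ L, so every window starts in the range where windows of c
   are distinct. *)
have lt_start r1 r2 : map c' (iota 0 (L.*2 * size t)) = r1 ++ u ++ r2 ->
    size r1 < n ^_ L.
  move=> /(congr1 size); rewrite size_map size_iota !size_cat szu size_tuple => szp.
  by apply: leq_trans Kn; rewrite -/L szp -addn1 leq_add2l.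
have : map c' (iota (size s1) L) = map c' (iota (size t1) L).
  by rewrite -szu -(map_iota_infix eqs) -(map_iota_infix eqt).
rewrite !c'E => /(inj_map lift_inj); apply: inj_c; rewrite inE.
- exact: lt_start eqs.
- exact: lt_start eqt.
Qed.

Lemma card_avoiding_words1 (q : nat) : 0 < q ->
  q <= #|[set w : 1.-tuple 'I_q | `[< avoids Z3 w /\ Z2_free_off_letter w >] ]|.
Proof.
case: q => // n _; rewrite -[X in X <= _]card_ord -[X in X <= _]expn1 -card_tuple -cardsT.
apply/subset_leq_card/fintype.subsetP => w _; rewrite inE; apply/asboolP.
have long (P : seq nat) (u : seq 'I_n.+1) : size u <= 1 ->
    (exists Q, P = [:: 1, 2 & Q]) -> avoids P u.
  move=> u1 [Q ->] [f [f0 /= /infixP[s1 [s2 eu]]]].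
  move: u1 (f0 1 isT) (f0 2 isT); rewrite eu; case: (f 1) (f 2) => // a v [//|b v'].
  by rewrite !size_cat /= ?size_cat /= !(addnS, addSn).
split; first by apply: long; [rewrite size_tuple | exists [:: 1; 3; 1; 2; 1]].
exists ord0 => u uw _; apply: long; last by exists [:: 1].
by rewrite -(size_tuple w); apply: size_infix.
Qed.

(** * Choice of the length for each q *)

Unset Implicit Arguments.

Local Open Scope classical_set_scope.
Local Open Scope ring_scope.

(* At q = 2, where L would be 0, words of length 1 suffice; truncated subtraction makes
   (q - 3)! = 1 there. *)
Definition word_length (q : nat) : nat :=
  if q == 2%N then 1%N else (q.-2.*2.+3 * (q - 3)`!)%N.

Lemma word_length_gt0 q : (0 < word_length q)%N.
Proof. by rewrite /word_length; case: ifP => // _; rewrite muln_gt0 fact_gt0. Qed.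

Lemma card_avoiding_words_ge (q : nat) : (2 <= q)%N ->
  (2 ^ (q - 3)`! <= #|[set w : (word_length q).-tuple 'I_q |
                        `[< avoids Z3 w /\ Z2_free_off_letter w >] ]%SET|)%N.
Proof.
rewrite leq_eqVlt => /predU1P[<-|]; first exact: (@card_avoiding_words1 2).
case: q => [|[|[|n]]] // _.
rewrite /word_length subSS subSS subSS subn0 /=.
apply: card_avoiding_words => //; rewrite [_.-1]/=.
(* Here L = n + 1, and the (n + 2)! repetition-free words leave room for 2 (n + 1) n! letters. *)
have := ffact_fact (leqnSn n.+1); rewrite subSnn factS fact0 !muln1 => ->.
by rewrite !factS mulnA leq_mul // -muln2 mulnC leq_mul.
Qed.

Lemma fact_le_expn (n q : nat) : (n <= q)%N -> (n`! <= q ^ n)%N.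
Proof.
elim: n => // n IHn nq; rewrite factS expnS leq_mul // IHn //; exact: ltnW.
Qed.

(** This bound makes g nonnegative. *)
Lemma word_length_le (q : nat) : (3 <= q)%N -> (word_length q <= q ^ q)%N.
Proof.
case: q => [|[|[|n]]] // _; rewrite /word_length subSS subSS subSS subn0 /=.
rewrite -[X in (_ ^ X)%N]addn3 addnC expnD leq_mul //; last by apply: fact_le_expn; lia.
by rewrite !expnS expn0 muln1; nia.
Qed.

(** * Asymptotic estimates *)

Section Asymptotics.
Variable R : realType.

(** A weak Stirling bound, by induction from n ln (1 + 1/n) <= 1. *)
Lemma ln_fact_ge (n : nat) : n%:R * ln n%:R - n%:R <= ln (n`!%:R : R).
Proof.
elim: n => [|n IHn]; first by rewrite fact0 ln1 mul0r subr0.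
have [->|n0] := posnP n; first by rewrite factS mul1n fact0 ln1 mulr0 sub0r lerN10.
have np : 0 < n%:R :> R by rewrite ltr0n.
rewrite factS natrM lnM ?posrE ?ltr0n ?fact_gt0 //.
have : ln (n.+1%:R / n%:R : R) <= n%:R^-1.
  rewrite -natr1 mulrDl divff ?gt_eqF // mul1r; apply: le_ln1Dx.
  by apply: lt_trans (_ : 0 < _); rewrite ?invr_gt0 // ltrN10.
rewrite ln_div ?posrE ?ltr0n // => /(ler_wpM2l (ltW np)).
rewrite divff ?gt_eqF // -natr1; lra.
Qed.

Lemma ln2_ge_half : 2^-1 <= ln (2 : R).
Proof.
have : ln (2^-1 : R) <= - 2^-1.
  have half : 1 + - 2^-1 = 2^-1 :> R by field.
  by rewrite -{1}half; apply: le_ln1Dx; lra.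
rewrite lnV ?posrE //; lra.
Qed.

(** The argument of the logarithm on the right is the base-q logarithm of 2 ^ (q - 3)!. Passing from
    q! to (q - 3)! costs at most 3 ln q and the factor ln 2 / ln q at most 2 ln q, whence the 5. *)
Lemma ln_count_ge (q : nat) : (3 <= q)%N ->
  q%:R * ln q%:R - q%:R - 5 * ln q%:R <= ln ((q - 3)`!%:R * (ln 2 / ln q%:R) : R).
Proof.
case: q => [|[|[|n]]] // _; rewrite subSS subSS subSS subn0; set q := n.+3.
have q0 : 0 < q%:R :> R by rewrite ltr0n.
have q3 : 3 <= q%:R :> R by rewrite ler_nat.
have lq0 : 0 < ln (q%:R : R) by apply: ln_gt0; lra.
have ln2_0 : 0 < ln 2 :> R by apply: ln_gt0; lra.
rewrite lnM ?posrE ?divr_gt0 ?ltr0n ?fact_gt0 //.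
have bf : ln (q`!%:R : R) <= ln (n`!%:R) + 3 * ln q%:R.
  have -> : 3 * ln (q%:R : R) = ln (q%:R ^+ 3) by rewrite lnXn // mulr_natl.
  rewrite -lnM ?posrE ?exprn_gt0 ?ltr0n ?fact_gt0 //.
  rewrite ler_ln ?posrE ?mulr_gt0 ?exprn_gt0 ?ltr0n ?fact_gt0 //.
  rewrite -natrX -natrM ler_nat /q !factS.
  have -> : (n.+3 * (n.+2 * (n.+1 * n`!)) = n`! * (n.+3 * (n.+2 * n.+1)))%N by ring.
  by rewrite leq_mul2l; apply/orP; right; rewrite leq_mul2l !mulnS; lia.
have bl : - (2 * ln (q%:R : R)) <= ln (ln 2 / ln q%:R).
  have -> : 2 * ln (q%:R : R) = ln (q%:R ^+ 2) by rewrite lnXn // mulr_natl.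
  rewrite -lnV ?posrE ?exprn_gt0 // ler_ln ?posrE ?invr_gt0 ?exprn_gt0 ?divr_gt0 //.
  rewrite ler_pdivlMr // mulrC ler_pdivrMr ?exprn_gt0 //.
  have : ln (q%:R : R) <= q%:R - 1.
    have q1 : 1 + (q%:R - 1) = q%:R :> R by ring.
    by rewrite -{1}q1; apply: le_ln1Dx; lra.
  have := ln2_ge_half; nra.
have := ln_fact_ge q; lra.
Qed.

Lemma ln_natr_cvgy : (ln (n%:R : R)) @[n --> \oo] --> +oo.
Proof.
apply/cvgryPge => A; near=> n.
have En : expR A <= n%:R by near: n; apply: cvgry_ge; exact: cvgr_idn.
by rewrite -[A]expRK ler_ln ?posrE ?expR_gt0 // (lt_le_trans (expR_gt0 A)).
Unshelve. all: by end_near. Qed.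

(** This is the common bound q / ln q + 5 for g and h, divided by q. *)
Lemma error_bound_cvg0 : ((ln (q%:R : R))^-1 + 5 * q%:R^-1) @[q --> \oo] --> (0 : R).
Proof.
have gt0_near (f : nat -> R) : f @ \oo --> +oo -> (fun n => (f n)^-1) @ \oo --> (0 : R).
  move=> fy; apply/gtr0_cvgV0 => //; near=> n.
  by apply: (@lt_le_trans _ _ 1) => //; near: n; apply: cvgry_ge.
rewrite -[X in _ --> X](addr0 (0 : R)) -{2}(mulr0 (5 : R)).
apply: cvgD; first exact/gt0_near/ln_natr_cvgy.
by apply: cvgMl_tmp; apply: gt0_near; exact: cvgr_idn.
Unshelve. all: by end_near. Qed.

End Asymptotics.

Theorem theorem3p3 (R : realType) :
  exists g h : nat -> R,
    [/\ (fun q : nat => g q / q%:R) @ \oo --> (0 : R),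
        (fun q : nat => h q / q%:R) @ \oo --> (0 : R) &
        forall q : nat, (2 <= q)%N ->
          exists N : nat,
            [/\ (0 < N)%N,
                log_base (q%:R : R) N%:R = q%:R - g q &
                (q%:R : R) `^ (q%:R `^ (q%:R - h q)) <=
                  #|[set w : N.-tuple 'I_q |
                      `[< avoids Z3 w /\ Z2_free_off_letter w >] ]%SET|%:R]].
Proof.
(* Both are defined by solving for them: h is such that q ^ (q ^ (q - h)) equals 2 ^ (q - 3)!
   exactly. *)
pose g (q : nat) : R := q%:R - log_base q%:R (word_length q)%:R.
pose h (q : nat) : R := q%:R - log_base q%:R ((q - 3)`!%:R * (ln 2 / ln q%:R)).
(* The middle inequality holds because (q - 3)! ln 2 / ln q <= (q - 3)! <= N. *)
have bounds q : (3 <= q)%N -> [/\ 0 <= g q, g q <= h q & h q <= q%:R / ln q%:R + 5].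
  move=> q3.
  have q0 : 0 < q%:R :> R by rewrite ltr0n (leq_trans _ q3).
  have q3R : 3 <= q%:R :> R by rewrite ler_nat.
  have lq0 : 0 < ln (q%:R : R) by apply: ln_gt0; lra.
  have ln2_0 : 0 < ln 2 :> R by apply: ln_gt0; lra.
  have wl0 : 0 < (word_length q)%:R :> R by rewrite ltr0n word_length_gt0.
  have f0 : 0 < (q - 3)`!%:R :> R by rewrite ltr0n fact_gt0.
  rewrite /g /h /log_base; split.
  - rewrite subr_ge0 ler_pdivrMr // mulrC mulr_natr -lnXn // ler_ln ?posrE ?exprn_gt0 //.
    by rewrite -natrX ler_nat word_length_le.
  - rewrite lerD2l lerN2 ler_pM2r ?invr_gt0 // ler_ln ?posrE ?mulr_gt0 ?invr_gt0 //.
    apply: (@le_trans _ _ (q - 3)`!%:R).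
      apply: ler_piMr; first exact: ltW.
      rewrite ler_pdivrMr // mul1r ler_ln ?posrE //; lra.
    by rewrite ler_nat /word_length gtn_eqF // leq_pmull.
  have -> : q%:R / ln q%:R + 5 = q%:R - (q%:R * ln q%:R - q%:R - 5 * ln q%:R) / ln q%:R :> R.
    by field; rewrite gt_eqF.
  by rewrite lerD2l lerN2 ler_pM2r ?invr_gt0 //; exact: ln_count_ge.
have squeeze (f : nat -> R) : (forall q, (3 <= q)%N -> 0 <= f q <= q%:R / ln q%:R + 5) ->
    (fun q : nat => f q / q%:R) @ \oo --> (0 : R).
  move=> fb; apply: (squeeze_cvgr _ (cvg_cst 0) (@error_bound_cvg0 R)).
  near=> q; have q3 : (3 <= q)%N by near: q; exists 3%N.
  have q0 : 0 < q%:R :> R by rewrite ltr0n (leq_trans _ q3).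
  have /andP[f0 fq] := fb _ q3.
  rewrite /=; apply/andP; split; first by apply: divr_ge0 => //; exact: ltW.
  rewrite ler_pdivrMr // mulrDl -[X in _ <= _ + X]mulrA.
  by rewrite mulVf ?gt_eqF // mulr1 mulrC.
exists g, h; split.
- by apply: squeeze => q /bounds[g0 gh hb]; rewrite g0 (le_trans gh).
- by apply: squeeze => q /bounds[g0 gh hb]; rewrite hb (le_trans g0).
move=> q q2; exists (word_length q); split; first exact: word_length_gt0.
  by rewrite /g opprB addrC subrK.
have q2R : 2 <= q%:R :> R by rewrite ler_nat.
have lq0 : 0 < ln (q%:R : R) by apply: ln_gt0; lra.
have ln2_0 : 0 < ln 2 :> R by apply: ln_gt0; lra.
have qn0 : q%:R != 0 :> R by rewrite gt_eqF //; lra.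
have powE x : q%:R `^ x = expR (x * ln q%:R) :> R by rewrite /powR (negPf qn0).
rewrite [X in _ `^ X]powE /h opprB addrC subrK /log_base divfK ?gt_eqF //.
rewrite lnK ?posrE ?mulr_gt0 ?invr_gt0 ?ltr0n ?fact_gt0 //.
rewrite powE mulrA divfK ?gt_eqF // expRM_natl lnK ?posrE // -natrX ler_nat.
exact: card_avoiding_words_ge.
Unshelve. all: by end_near. Qed.
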